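(* Let $L$ be an A-loop. The following are equivalent: (1) $L$ has the inverse property, i.e. $x^{-1}(xy)=y$ and $(xy)y^{-1}=x$ for all $x,y\in L$; (2) $L$ has the alternative property, i.e. $x(xy)=x^{2}y$ and $(xy)y=xy^{2}$ for all $x,y\in L$; (3) $L$ is diassociative; (4) $L$ is a Moufang loop.
   Context: A loop $(L,\cdot)$ is a nonempty set $L$ with a binary operation $\cdot$ (usually written as juxtaposition) such that (i) for all $a,b\in L$ the equations $ax=b$ and $ya=b$ each have unique solutions $x,y\in L$, and (ii) there is an identity element $1\in L$ with $1x=x1=x$ for all $x\in L$. For $x\in L$ the left and right translations are the permutations of $L$ defined (maps written on the right) by $yL(x)=xy$ and $yR(x)=yx$. The multiplication group $\mathrm{Mlt}(L)$ is the permutation group on $L$ generated by all $L(x),R(x)$, $x\in L$. The inner mapping group $\mathrm{Mlt}_1(L)$ is the subgroup of $\mathrm{Mlt}(L)$ fixing $1$; its elements are the inner mappings. An A-loop is a loop in which every inner mapping is an automorphism of $L$. A-loops are power associative (every one-element-generated subloop $\langle x\rangle$ is a group), so $x^{-1}$ denotes the two-sided inverse of $x$, and $x^2=xx$. A loop $L$ is diassociative if for all $x,y\in L$ the subloop $\langle x,y\rangle$ generated by $x,y$ is a group. A Moufang loop is a loop satisfying $x(y(xz))=((xy)x)z$ for all $x,y,z$. *)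

(* Defs.v *)
From Stdlib Require Import IndefiniteDescription.
From mathcomp Require Import all_boot.

Set Implicit Arguments.
Unset Strict Implicit.
Unset Printing Implicit Defensive.

Record loop := Loop {
  carrier :> Type;
  mul : carrier -> carrier -> carrier;
  one : carrier;
  mul_lsolve : forall a b, exists! x, mul a x = b;
  mul_rsolve : forall a b, exists! y, mul y a = b;
  mul1l : forall x, mul one x = x;
  mull1 : forall x, mul x one = x
}.

Arguments one {l}.

Declare Scope loop_scope.
Delimit Scope loop_scope with L.
Local Open Scope loop_scope.
Notation "x * y" := (mul x y) : loop_scope.
Notation "1" := one : loop_scope.

Section LoopDefs.
Variable L : loop.
Implicit Types (x y z : L) (f g : L -> L) (A : L -> Prop).

Definition ltrans x : L -> L := fun y => x * y.
Definition rtrans x : L -> L := fun y => y * x.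

(* The subgroup of Sym(L) generated by all translations. The last constructor
   closes under inverses, and also makes membership extensional in f. *)
Inductive Mlt : (L -> L) -> Prop :=
| Mlt_ltrans x : Mlt (ltrans x)
| Mlt_rtrans x : Mlt (rtrans x)
| Mlt_id : Mlt id
| Mlt_comp f g : Mlt f -> Mlt g -> Mlt (f \o g)
| Mlt_inv f g : Mlt f -> cancel f g -> cancel g f -> Mlt g.

Definition inner_mapping f : Prop := Mlt f /\ f 1 = 1.

Definition automorphism f : Prop :=
  bijective f /\ {morph f : x y / x * y}.

Definition A_loop : Prop := forall f, inner_mapping f -> automorphism f.

(* The right inverse in a general loop; two-sided in an A-loop, by
   A_loop_mulVl below. *)
Definition inv x : L :=
  proj1_sig (constructive_indefinite_description _ (mul_lsolve x 1)).

Definition inverse_property : Prop :=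
  forall x y, inv x * (x * y) = y /\ (x * y) * inv y = x.

Definition alternative_property : Prop :=
  forall x y, x * (x * y) = (x * x) * y /\ (x * y) * y = x * (y * y).

Definition subloop A : Prop :=
  [/\ A 1,
      forall a b, A a -> A b -> A (a * b),
      forall a b x, A a -> A b -> a * x = b -> A x
    & forall a b y, A a -> A b -> y * a = b -> A y].

Definition generated2 x y : L -> Prop :=
  fun z => forall A, subloop A -> A x -> A y -> A z.

Definition is_group A : Prop :=
  [/\ A 1,
      forall a b, A a -> A b -> A (a * b),
      forall a b c, A a -> A b -> A c -> a * (b * c) = (a * b) * c
    & forall a, A a -> exists b, [/\ A b, a * b = 1 & b * a = 1]].

Definition diassociative : Prop := forall x y, is_group (generated2 x y).

Definition Moufang : Prop :=
  forall x y z, x * (y * (x * z)) = ((x * y) * x) * z.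

Lemma mullV x : x * inv x = 1.
Proof.
by rewrite /inv; case: (constructive_indefinite_description _ _) => v [].
Qed.

Lemma ltrans_bij x : bijective (ltrans x).
Proof.
pose g y := proj1_sig (constructive_indefinite_description _ (mul_lsolve x y)).
have gP y : x * g y = y.
  by rewrite /g; case: (constructive_indefinite_description _ _) => v [].
exists g => y; last exact: gP.
have [v [_ vU]] := mul_lsolve x (x * y).
by rewrite -(vU (g (x * y)) (gP _)) -(vU y erefl).
Qed.

(* The inner mapping y |-> x \ (y x) fixes x and 1, hence fixes inv x. *)
Lemma A_loop_mulVl : A_loop -> forall x, inv x * x = 1.
Proof.
move=> HL x; have [g Kg gK] := ltrans_bij x.
have Mg : Mlt g by apply: (Mlt_inv (Mlt_ltrans x)).
have gx : g x = 1 by rewrite -[x in g x]mull1 -[x * 1]/(ltrans x 1) Kg.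
have gxx : g (x * x) = x by rewrite -[x * x]/(ltrans x x) Kg.
have [_ fM] : automorphism (g \o rtrans x).
  apply: HL; split; first by apply: Mlt_comp => //; apply: Mlt_rtrans.
  by rewrite /= /rtrans mul1l.
have := fM x (inv x); rewrite /= /rtrans mullV mul1l gx gxx => e.
have [v [_ vU]] := mul_lsolve x 1.
have e2 : g (inv x * x) = inv x by rewrite -(vU _ (esym e)) -(vU _ (mullV x)).
by rewrite -(gK (inv x * x)) e2 /ltrans mullV.
Qed.

End LoopDefs.

(* Main.v *)
Require Import Defs.
From Stdlib Require Import IndefiniteDescription.
From mathcomp Require Import all_boot.
Import Defs.

(* Write P(x,y) = L_(xy)^-1 L_x L_y (linn below) and
   c(x,z) = L_x^-1 R_z^-1 L_x R_z (cinn below).  In an A-loop with the inverse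
   property both are automorphisms, P(x,y) fixes x and y, and c(x,z) fixes x
   and z.  Diassociativity follows because the fixed points of an automorphism
   form a subloop.  Comparing the bracketings of three elements gives
     x(yz) = (xy) P(x,y)z = (x c(x,z)y) z = (P(y,z)x y) z,
   and together with the cocycle identity
     P(x,y) P(xy,z) = P(x,yz) P(y,z)
   this leads to
     (b^-1 P(a,b)y) y = b^-1 (y c(b,a)y).
   So P(a,b) depends only on b and c(b,a), whence P(ab,b) = P(a,b).  Combined
   with the symmetry P((xy)^-1,x) = P(x,y) this gives P(xy,x) = P(x,y)^-1,
   that is, L_x L_y L_x = L_((xy)x). *)

Set Implicit Arguments.
Unset Strict Implicit.
Unset Printing Implicit Defensive.

Local Open Scope loop_scope.

Section LoopTheory.
Variable L : loop.
Implicit Types (a b u v x y z : L) (f g : L -> L) (A : L -> Prop).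

(** * Cancellation, homomorphisms and subloops *)

Lemma mul_injl a x y : a * x = a * y -> x = y.
Proof. exact: (bij_inj (ltrans_bij a)). Qed.

Lemma mul_injr a x y : x * a = y * a -> x = y.
Proof.
move=> e; have [v [_ vU]] := mul_rsolve a (x * a).
by rewrite -(vU x erefl) -(vU y (esym e)).
Qed.

Lemma rtrans_bij a : bijective (rtrans a).
Proof.
pose g y := sval (constructive_indefinite_description _ (mul_rsolve a y)).
have gP : cancel g (rtrans a).
  by move=> y; rewrite /g; case: constructive_indefinite_description => v [].
by exists g => // y; apply: (@mul_injr a); apply: gP.
Qed.

Lemma morph_one f : {morph f : x y / x * y} -> f 1 = 1.
Proof. by move=> fM; apply: (@mul_injl (f 1)); rewrite -fM !mull1. Qed.

Lemma morph_inv f : {morph f : x y / x * y} -> {morph f : x / inv x}.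
Proof.
by move=> fM x; apply: (@mul_injl (f x)); rewrite -fM !mullV morph_one.
Qed.

Lemma subloop_fixed f : {morph f : x y / x * y} -> subloop (fun x => f x = x).
Proof.
move=> fM; split=> [|a b fa fb|a b x fa fb e|a b y fa fb e].
- exact: morph_one.
- by rewrite fM fa fb.
- by apply: (@mul_injl a); rewrite -[in LHS]fa -fM e.
- by apply: (@mul_injr a); rewrite -[in LHS]fa -fM e.
Qed.

Lemma subloop_inv A a : subloop A -> A a -> A (inv a).
Proof. by move=> [A1 _ Adiv _] Aa; apply: Adiv Aa A1 (mullV a). Qed.

Lemma subloop_generated2 x y : subloop (generated2 x y).
Proof.
split=> [|a b Sa Sb|a b u Sa Sb e|a b u Sa Sb e]
  A AS Ax Ay; have [? AM Al Ar] := AS => //.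
- by apply: AM; [apply: Sa | apply: Sb].
- by apply: Al e; [apply: Sa | apply: Sb].
- by apply: Ar e; [apply: Sa | apply: Sb].
Qed.

Lemma Moufang_inverse_property : Moufang L -> inverse_property L.
Proof.
move=> M x y; split.
  by apply: (@mul_injl x); rewrite M mullV mul1l.
(* Writing [x] as [y * v] makes the Moufang identity with third factor [inv y] applicable. *)
have [v [<- _]] := mul_lsolve y x.
by rewrite -M mullV mull1.
Qed.

Hypothesis HL : A_loop L.

(** The mapping g^-1 f fixes 1, so it is inner, hence an automorphism. *)
Lemma A_loop_factor f g :
    Mlt f -> Mlt g -> bijective g -> f 1 = g 1 ->
  exists2 h, {morph h : x y / x * y} & forall z, f z = g (h z).
Proof.
move=> Mf Mg [k gK kK] fg1; have Mk := Mlt_inv Mg gK kK.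
exists (k \o f); last by move=> z; rewrite /= kK.
by apply: proj2 (HL _); split; [apply: Mlt_comp | rewrite /= fg1 gK].
Qed.

Lemma diassociative_inverse_property : diassociative L -> inverse_property L.
Proof.
move=> D x y; have [_ _ A _] := D x y; have S := subloop_generated2 x y.
have Sx : generated2 x y x by move=> B.
have Sy : generated2 x y y by move=> B.
have SVx := subloop_inv S Sx; have SVy := subloop_inv S Sy.
by rewrite A // (A_loop_mulVl HL) mul1l -A // mullV mull1.
Qed.

(* By alternativity the inner mappings L(a,b) and R(b,a) fix b, hence b^-1;
   this yields (ab)b^-1 = a and b^-1(ba) = a. *)
Lemma alternative_inverse_property :
  alternative_property L -> inverse_property L.
Proof.
move=> AP x y; split.
  have [||||h hM hE] := @A_loop_factor (rtrans y \o rtrans x) (rtrans (x * y)).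
  - by apply: Mlt_comp; apply: Mlt_rtrans.
  - exact: Mlt_rtrans.
  - exact: rtrans_bij.
  - by rewrite /= /rtrans !mul1l.
  rewrite /rtrans /= in hE.
  have hx : h x = x.
    by apply: (@mul_injr (x * y)); rewrite -hE; case: (AP x y).
  by have := hE (inv x); rewrite (morph_inv hM) hx (A_loop_mulVl HL) mul1l.
have [||||h hM hE] := @A_loop_factor (ltrans x \o ltrans y) (ltrans (x * y)).
- by apply: Mlt_comp; apply: Mlt_ltrans.
- exact: Mlt_ltrans.
- exact: ltrans_bij.
- by rewrite /= /ltrans !mull1.
rewrite /ltrans /= in hE.
have hy : h y = y.
  by apply: (@mul_injl (x * y)); rewrite -hE; case: (AP x y).
by have := hE (inv y); rewrite (morph_inv hM) hy mullV mull1.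
Qed.

(** * Inner mappings under the inverse property *)

Section InverseProperty.
Hypothesis IP : inverse_property L.

Lemma mulVl x : inv x * x = 1.
Proof. exact: A_loop_mulVl. Qed.

Lemma mulVK x y : inv x * (x * y) = y.
Proof. by case: (IP x y). Qed.

Lemma mulrK x y : (x * y) * inv y = x.
Proof. by case: (IP x y). Qed.

Lemma invK x : inv (inv x) = x.
Proof. by apply: (@mul_injl (inv x)); rewrite mullV mulVl. Qed.

Lemma mulKV x y : x * (inv x * y) = y.
Proof. by rewrite -{1}[x]invK mulVK. Qed.

Lemma mulrKV x y : (x * inv y) * y = x.
Proof. by rewrite -{2}[y]invK mulrK. Qed.

Lemma invM x y : inv (x * y) = inv y * inv x.
Proof. by rewrite -[LHS](mulrK _ x) -{2}[x](mulrK x y) mulVK. Qed.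

Definition linn x y u := inv (x * y) * (x * (y * u)).

Definition cinn x z u := inv x * ((x * (u * z)) * inv z).

Lemma linnM x y : {morph linn x y : u v / u * v}.
Proof.
apply: proj2 (HL _); split; last by rewrite /linn mull1 mulVl.
apply: (@Mlt_comp _ (ltrans _)); first exact: Mlt_ltrans.
by apply: (@Mlt_comp _ (ltrans _) (ltrans _)); apply: Mlt_ltrans.
Qed.

Lemma cinnM x z : {morph cinn x z : u v / u * v}.
Proof.
apply: proj2 (HL _); split; last by rewrite /cinn mul1l mulrK mulVl.
apply: (@Mlt_comp _ (ltrans _)); first exact: Mlt_ltrans.
apply: (@Mlt_comp _ (rtrans _)); first exact: Mlt_rtrans.
apply: (@Mlt_comp _ (ltrans _) (rtrans _)); first exact: Mlt_ltrans.
exact: Mlt_rtrans.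
Qed.

Lemma linnE x y u : x * (y * u) = (x * y) * linn x y u.
Proof. by rewrite /linn mulKV. Qed.

Lemma cinnE x z u : x * (u * z) = (x * cinn x z u) * z.
Proof. by rewrite /cinn mulKV mulrKV. Qed.

(** The inverse property gives x(y(xy)^-1) = 1, so P(x,y) fixes (xy)^-1 and therefore xy. *)
Lemma linn_mul x y : linn x y (x * y) = x * y.
Proof.
have e : x * (y * inv (x * y)) = 1 by rewrite invM mulKV mullV.
rewrite -[x * y in LHS]invK (morph_inv (linnM x y)).
by rewrite /linn e mull1 invK.
Qed.

Lemma linnl x y : linn x y x = x.
Proof. by rewrite -{2}(mulrK x y) linnM linn_mul -linnE mullV mull1. Qed.

Lemma linnr x y : linn x y y = y.
Proof. by apply: (@mul_injl x); rewrite -{1}(linnl x y) -linnM linn_mul. Qed.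

(** P(x,y) fixes y, which is the right law; inversion turns it into the left one. *)
Lemma inverse_alternative_property : alternative_property L.
Proof.
have altr x y : (x * y) * y = x * (y * y) by rewrite linnE linnr.
move=> x y; split=> //; rewrite -[LHS]invK -[RHS]invK.
by congr (inv _); rewrite !invM altr.
Qed.

Lemma altl x y : x * (x * y) = (x * x) * y.
Proof. by case: (inverse_alternative_property x y). Qed.

Lemma flex x y : x * (y * x) = (x * y) * x.
Proof. by rewrite linnE linnl. Qed.

(** Inverting [linnE] at u^-1 expresses the same P(x,y) through right translations. *)
Lemma linnE_r x y u : (u * inv y) * inv x = linn x y u * inv (x * y).
Proof.
rewrite -{2}[u]invK (morph_inv (linnM x y)) -invM -linnE.
by rewrite [in RHS]invM [in RHS]invM invK.
Qed.

Lemma linn_assoc x y z : x * (y * z) = (linn y z x * y) * z.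
Proof.
have <- : ((x * (y * z)) * inv z) * inv y = linn y z x by
  rewrite linnE_r linnM linn_mul mulrK.
by rewrite !mulrKV.
Qed.

Lemma cinnl x z : cinn x z x = x.
Proof. by apply: (@mul_injl x); apply: (@mul_injr z); rewrite -cinnE altl. Qed.

Lemma cinnr x z : cinn x z z = z.
Proof.
by apply: (@mul_injl x); apply: (@mul_injr z); rewrite -cinnE linnE linnr.
Qed.

Lemma inverse_diassociative : diassociative L.
Proof.
move=> x y; set S := generated2 x y.
have SS : subloop S := subloop_generated2 x y.
have [S1 SM _ _] := SS.
have Sfix f : {morph f : u v / u * v} -> f x = x -> f y = y ->
    forall u, S u -> f u = u.
  by move=> fM fx fy u Su; apply: Su (subloop_fixed fM) fx fy.
(* [N] will be a subloop containing [x] and [y], so it exhausts [S]. *)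
pose N a := S a /\ forall u v, S u -> S v -> a * (u * v) = (a * u) * v.
have Sx : S x by move=> A.
have Sy : S y by move=> A.
have Nx : N x.
  split=> // u v Su Sv; rewrite linnE (Sfix _ (linnM x u)) ?linnl //.
  (* It remains that P(x,u) fixes y: c(x,y) fixes x and y, hence u, so x(uy) = (xu)y. *)
  apply: (@mul_injl (x * u)); rewrite -linnE cinnE (Sfix _ (cinnM x y)) //.
    exact: cinnl.
  exact: cinnr.
have Ny : N y.
  split=> // u v Su Sv; rewrite linnE (Sfix _ (linnM y u)) ?linnl //.
  apply: (@mul_injl (y * u)); rewrite -linnE cinnE (Sfix _ (cinnM y x)) //.
    exact: cinnr.
  exact: cinnl.
have NM a b : N a -> N b -> N (a * b).
  move=> [Sa Na] [Sb Nb]; split=> [|u v Su Sv]; first exact: SM.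
  by rewrite -Na ?Nb ?Na ?Nb //; apply: SM => //; apply: SM.
have NV a : N a -> N (inv a).
  move=> [Sa Na]; have SVa := subloop_inv SS Sa; split=> // u v Su Sv.
  by apply: (@mul_injl a); rewrite mulKV Na ?mulKV //; apply: SM.
have NS : subloop N.
  split=> [|//|a b u Na Nb e|a b u Na Nb e].
  - by split=> // u v _ _; rewrite !mul1l.
  - by rewrite -(mulVK a u) e; apply: NM => //; apply: NV.
  - by rewrite -(mulrK u a) e; apply: NM => //; apply: NV.
split=> // [a b c Sa Sb Sc|a Sa].
  by have [_ ->] := Sa _ NS Nx Ny.
by exists (inv a); rewrite mullV mulVl; split=> //; apply: subloop_inv SS Sa.
Qed.

(** * Identities between P and c *)

Lemma morph_linn f x y u : {morph f : u v / u * v} ->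
  f (linn x y u) = linn (f x) (f y) (f u).
Proof. by move=> fM; rewrite /linn !(fM, morph_inv fM). Qed.

Lemma morph_cinn f x z u : {morph f : u v / u * v} ->
  f (cinn x z u) = cinn (f x) (f z) (f u).
Proof. by move=> fM; rewrite /cinn !(fM, morph_inv fM). Qed.

Lemma linnVK x y u : linn (inv x) (x * y) (linn x y u) = u.
Proof. by rewrite {1}/linn -linnE !mulVK. Qed.

Lemma linn_mulVK x y u : linn (x * y) (inv y) (linn x y u) = u.
Proof.
have e : inv y * linn x y u = linn x y (inv y * u).
  by rewrite linnM (morph_inv (linnM x y)) linnr.
by rewrite {1}/linn mulrK e -linnE mulKV mulVK.
Qed.

Lemma linn_rot x y u : linn (inv (x * y)) x u = linn x y u.
Proof.
have -> : linn x y u = y * linn x y (inv y * u).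
  by rewrite linnM (morph_inv (linnM x y)) linnr mulKV.
have e : inv (x * y) * x = inv y by rewrite invM mulrKV.
by rewrite /linn e invK mulKV.
Qed.

(** Both sides arise from x(y(zu)); the automorphism P(x,y) acts on the parameters of P(xy,z) and
    fixes xy. *)
Lemma linn_cocycle x y z u :
  linn x y (linn (x * y) z u) = linn x (y * z) (linn y z u).
Proof.
apply: (@mul_injl (x * (y * z))); rewrite -linnE -linnE.
rewrite (morph_linn _ _ _ (linnM x y)) linn_mul (linnE x y z) -linnE.
by rewrite -linnM -linnE.
Qed.

Lemma linnKV x y u : linn x y (linn (inv x) (x * y) u) = u.
Proof. by have := linnVK (inv x) (x * y) u; rewrite invK mulVK. Qed.

(** Inverting [cinnE] exchanges the two parameters of c. *)
Lemma cinnC x z u : cinn z x (cinn x z u) = u.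
Proof.
have e v : (inv z * v) * inv x = inv z * (cinn x z v * inv x).
  have := congr1 (@inv L) (cinnE x z (inv v)).
  by rewrite (morph_inv (cinnM x z)) !invM !invK.
have := e (z * (u * x)); rewrite mulVK mulrK !(cinnM x z) cinnl cinnr.
by move/esym.
Qed.

(** P(x,y) fixes x and y and so commutes with c(x,y); after rebracketing, flexibility finishes. *)
Lemma cinn_mull x y u : cinn x (x * y) u = cinn x y u.
Proof.
apply: (@mul_injl x); apply: (@mul_injr (x * y)); rewrite -cinnE.
rewrite [RHS]linn_assoc [u * _]linn_assoc linnM linnl.
by rewrite (morph_cinn _ _ _ (linnM x y)) linnl linnr cinnE cinnM cinnl flex.
Qed.

Lemma cinn_mulr x z u : cinn x (z * x) u = cinn x z u.
Proof.
apply: (@mul_injl x); apply: (@mul_injr (z * x)); rewrite -cinnE.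
rewrite [RHS]linn_assoc [u * _]linn_assoc linnM linnr.
by rewrite (morph_cinn _ _ _ (linnM z x)) linnl linnr flex cinnE.
Qed.

Lemma linn_cinn x y z : linn y z x * y = x * cinn x z y.
Proof. by apply: (@mul_injr z); rewrite -linn_assoc cinnE. Qed.

Lemma linn_cinn_r y z u : y * u = cinn (linn z y u) z y * linn z y u.
Proof.
by apply: (@mul_injl z); rewrite linnE [RHS]cinnE cinnC.
Qed.

Lemma linn_mul_l x y z : linn z (x * y) x = linn z y x.
Proof. by apply: (@mul_injr z); rewrite !linn_cinn cinn_mull. Qed.

Lemma linn_mul_r x y z : linn z (x * y) y = linn z x y.
Proof. by have := linn_cocycle z x y y; rewrite !linnr. Qed.

(** P(z,yx) fixes yx, and it agrees with P(z,x) at y and with P(z,y) at x. *)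
Lemma linn_swap x y z : linn z x y * linn z y x = y * x.
Proof. by rewrite -(linn_mul_l y x) -(linn_mul_r y x) -linnM linnr. Qed.

Lemma linn_exchange x y z : linn z x y = linn z y (cinn x z y).
Proof.
apply: (@mul_injr (linn z y x)); rewrite linn_swap -linnM.
(* The argument is the preimage of x under P(z,y), so that the factor c(x,z)y appears. *)
have := linn_cinn_r y z (linn (inv z) (z * y) x); rewrite linnKV => <-.
by rewrite linnM linnr linnKV.
Qed.

(** Both sides equal (c(y,ab)b^-1 y)y, by [linn_cinn_r] at two different arguments. *)
Lemma linn_determined a b y :
  (inv b * linn a b y) * y = inv b * (y * cinn b a y).
Proof.
set s := linn a b y; set t := cinn b a y.
have s1 : linn (a * b) (inv b) s = y by apply: linn_mulVK.
have y1 : linn (a * b) (inv b * y) (linn (inv b) y t) = y.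
  (* As (ab)b^-1 = a, the left side is P(ab,b^-1) P(a,y)t, and P(a,y)t = s. *)
  by rewrite -linn_cocycle mulrK -linn_exchange.
have := linn_cinn_r (inv b) (a * b) s; rewrite s1 => ->.
have := linn_cinn_r (inv b * y) (a * b) (linn (inv b) y t).
by rewrite y1 -linnE cinnM cinnl.
Qed.

Lemma linn_mull a b y : linn (a * b) b y = linn a b y.
Proof.
apply: (@mul_injl (inv b)); apply: (@mul_injr y).
by rewrite !linn_determined cinn_mulr.
Qed.

Lemma inverse_Moufang : Moufang L.
Proof.
move=> x y z; rewrite linnE linnM linnl linnE; congr (_ * _).
(* P(xy,x) = P(((xy)x)^-1,xy) = P(x^-1,xy), which inverts P(x,y). *)
rewrite -linn_rot -linn_mull [inv (_ * x)]invM mulrKV.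
exact: linnVK.
Qed.

End InverseProperty.
End LoopTheory.

Theorem corollary1 (L : loop) (HL : A_loop L) :
  [<-> inverse_property L; alternative_property L; diassociative L; Moufang L].
Proof.
split; last split; last split.
- exact: inverse_alternative_property.
- by move/(alternative_inverse_property HL)/(inverse_diassociative HL).
- by move/(diassociative_inverse_property HL)/(inverse_Moufang HL).
- exact: Moufang_inverse_property.
Qed.
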